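(* Let $C$ be the canonical solution. Then the subset consequence generator $\mathcal{D}_{\mathrm{op}}$ is well-founded and complete w.r.t. $\mathcal{D}(C)$. Hence $F\in\mathrm{SF}_{\mathcal{D}_{\mathrm{op}}}(\mathcal{D}(C))$ for all minimal solutions $F$, and $\mathrm{SF}_{\mathcal{D}_{\mathrm{op}}}$ always terminates.
   Context: Setting: a quantifier-free $F$ with free variable $x$, a 1-grammar $U\circ V$ with $U=\{u_1,\ldots,u_m\}$, $V=\{s_1,\ldots,s_k\}$, and $\Gamma=F\{x\mapsto u_1\},\ldots,F\{x\mapsto u_m\}$ ($\{x\mapsto t\}$ denotes substitution). $\alpha$ is treated as a constant and $\models$ is propositional consequence. A quantifier-free $A$ is a solution if $\Gamma, A\supset\bigwedge_{j=1}^k A\{\alpha\mapsto s_j\}\rightarrow$ is a tautology; the canonical solution is $C=\bigwedge_{i=1}^m F\{x\mapsto u_i\}$; a minimal solution is a CNF solution (set of clauses) of minimal symbol complexity. $\mathcal{D}(A)$, the deductive closure of a clause set $A$, is the least superset of $A$ such that for all $C_1,C_2\in\mathcal{D}(A)$ whose propositional resolvent $\mathrm{res}(C_1,C_2)$ is defined (exactly one complementary literal pair) some $C\in\mathcal{D}(A)$ satisfies $C\subseteq\mathrm{res}(C_1,C_2)$. The subset consequence generator is $\mathcal{D}_{\mathrm{op}}(A)=\{B\subset A\mid |B|=|A|-1\}$. Completeness/well-foundedness of a consequence generator $\mathcal{C}$: complete w.r.t. $A$ if every minimal solution $B$ with $A\models B$ is reachable from $A$ by iterating $\mathcal{C}$;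 well-founded if some well-founded order decreases along $\mathcal{C}$. $\mathrm{SF}_{\mathcal{C}}(A)$ removes $\alpha$-free clauses from $A$, then recursively collects $A$ and $\mathrm{SF}_{\mathcal{C}}(B)$ for all $B\in\mathcal{C}(A)$ with $B\{\alpha\mapsto s_1\},\ldots,B\{\alpha\mapsto s_k\},\Gamma\rightarrow$ valid, returning the minimum.
   Formalization: A least superset as in the definition of D(A) need not exist (e.g. A={{p},{¬p,q}}: add {q} or the empty clause); D(A) is taken as the least such superset among sets of clauses derivable from A by resolution, which agrees with the original whenever that exists. *)

(* Defs.v *)
(* Classical logic (mathcomp.classical.boolp) supplies decidable equality and
   choice on terms and atoms, and turns the validity test of the search procedure into
   a boolean. *)
From HB Require Import structures.
From Stdlib Require Import Relation_Operators.
From mathcomp Require Import all_boot finmap.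
From mathcomp Require Import boolp.

Set Implicit Arguments.
Unset Strict Implicit.
Unset Printing Implicit Defensive.

Local Open Scope fset_scope.
Local Open Scope nat_scope.

Record signature := Signature {
  fsym : Type;
  far : fsym -> nat;
  psym : Type;
  par : psym -> nat }.

(* Variables are natural numbers; a constant is a function symbol of arity 0. *)
Inductive term (Sg : signature) : Type :=
| Var of nat
| App (f : fsym Sg) of {ffun 'I_(far f) -> term Sg}.

HB.instance Definition _ (Sg : signature) := gen_eqMixin (term Sg).
HB.instance Definition _ (Sg : signature) := gen_choiceMixin (term Sg).

Inductive atom (Sg : signature) : Type :=
| Pred (p : psym Sg) of {ffun 'I_(par p) -> term Sg}.

HB.instance Definition _ (Sg : signature) := gen_eqMixin (atom Sg).
HB.instance Definition _ (Sg : signature) := gen_choiceMixin (atom Sg).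

Inductive form (Sg : signature) : Type :=
| Atom of atom Sg
| Top
| Bot
| Neg of form Sg
| And of form Sg & form Sg
| Or of form Sg & form Sg
| Imp of form Sg & form Sg.

Arguments Var {Sg}.
Arguments Top {Sg}.
Arguments Bot {Sg}.

(* (true, a) is the literal a, (false, a) is its negation. *)
Notation literal Sg := (bool * atom Sg)%type.
Notation clause Sg := {fset (literal Sg)}.
Notation cset Sg := {fset (clause Sg)}.

Section Syntax.
Variable Sg : signature.

(* [subst_term y s t] is t{y |-> s}. *)
Fixpoint subst_term (y : nat) (s t : term Sg) : term Sg :=
  match t with
  | Var z => if z == y then s else Var z
  | App f a => App [ffun i => subst_term y s (a i)]
  end.

Definition subst_atom (y : nat) (s : term Sg) (a : atom Sg) : atom Sg :=
  let: Pred p b := a in Pred [ffun i => subst_term y s (b i)].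

Fixpoint subst_form (y : nat) (s : term Sg) (A : form Sg) : form Sg :=
  match A with
  | Atom a => Atom (subst_atom y s a)
  | Top => Top
  | Bot => Bot
  | Neg B => Neg (subst_form y s B)
  | And B1 B2 => And (subst_form y s B1) (subst_form y s B2)
  | Or B1 B2 => Or (subst_form y s B1) (subst_form y s B2)
  | Imp B1 B2 => Imp (subst_form y s B1) (subst_form y s B2)
  end.

Fixpoint occurs_term (y : nat) (t : term Sg) : bool :=
  match t with
  | Var z => z == y
  | App f a => has (fun i => occurs_term y (a i)) (enum 'I_(far f))
  end.

Definition occurs_atom (y : nat) (a : atom Sg) : bool :=
  let: Pred p b := a in has (fun i => occurs_term y (b i)) (enum 'I_(par p)).

Fixpoint term_size (t : term Sg) : nat :=
  match t with
  | Var _ => 1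
  | App f a => (\sum_(i < far f) term_size (a i)).+1
  end.

Definition atom_size (a : atom Sg) : nat :=
  let: Pred p b := a in (\sum_(i < par p) term_size (b i)).+1.

(* Atoms are independent of each other: no valuation of terms is involved, so
   variables (the eigenvariable included) behave as constants. *)
Fixpoint holds (v : atom Sg -> bool) (A : form Sg) : bool :=
  match A with
  | Atom a => v a
  | Top => true
  | Bot => false
  | Neg B => ~~ holds v B
  | And B1 B2 => holds v B1 && holds v B2
  | Or B1 B2 => holds v B1 || holds v B2
  | Imp B1 B2 => holds v B1 ==> holds v B2
  end.

Definition entails (A B : form Sg) : Prop :=
  forall v, holds v A -> holds v B.

Definition equivalent (A B : form Sg) : Prop :=
  forall v, holds v A = holds v B.

Definition tautological_sequent (G D : seq (form Sg)) : Prop :=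
  forall v, all (holds v) G -> has (holds v) D.

Definition bigAnd (s : seq (form Sg)) : form Sg := foldr (@And Sg) Top s.
Definition bigOr (s : seq (form Sg)) : form Sg := foldr (@Or Sg) Bot s.

Definition dual (l : literal Sg) : literal Sg := (~~ l.1, l.2).

Definition lit_form (l : literal Sg) : form Sg :=
  if l.1 then Atom l.2 else Neg (Atom l.2).

Definition clause_form (c : clause Sg) : form Sg :=
  bigOr [seq lit_form l | l <- enum_fset c].

Definition cset_form (A : cset Sg) : form Sg :=
  bigAnd [seq clause_form c | c <- enum_fset A].

Definition clause_occurs (y : nat) (c : clause Sg) : bool :=
  has (fun l : literal Sg => occurs_atom y l.2) (enum_fset c).

Definition lit_size (l : literal Sg) : nat := atom_size l.2 + ~~ l.1.

(* Symbol complexity: all occurrences of variables, function symbols, predicate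
   symbols, negations, and of the binary connectives that join n literals
   (n - 1 disjunctions) or n clauses (n - 1 conjunctions). The empty clause is
   the one-symbol formula bottom; the empty clause set has no symbols. *)
Definition clause_size (c : clause Sg) : nat :=
  if c == fset0 then 1
  else (\sum_(l <- enum_fset c) lit_size l) + #|` c|.-1.

Definition cset_size (A : cset Sg) : nat :=
  (\sum_(c <- enum_fset A) clause_size c) + #|` A|.-1.

Definition is_cnf_of (K : cset Sg) (A : form Sg) : Prop :=
  equivalent (cset_form K) A.

(* The resolvent of c1 and c2 is defined when exactly one literal l of c1 has
   its dual in c2. *)
Definition is_resolvent (c1 c2 r : clause Sg) : Prop :=
  exists2 l : literal Sg, [fset k in c1 | dual k \in c2] = [fset l]
    & r = (c1 `\ l) `|` (c2 `\ dual l).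

Inductive derivable (A : cset Sg) : clause Sg -> Prop :=
| derivable_base c : c \in A -> derivable A c
| derivable_res c1 c2 r : derivable A c1 -> derivable A c2 ->
    is_resolvent c1 c2 r -> derivable A r.

Definition resolution_closed (S : cset Sg) : Prop :=
  forall c1 c2 r, c1 \in S -> c2 \in S -> is_resolvent c1 c2 r ->
    exists2 c, c \in S & c `<=` r.

Definition closed_extension (A S : cset Sg) : Prop :=
  [/\ A `<=` S, forall c, c \in S -> derivable A c & resolution_closed S].

(* D is the least superset of A that is closed under resolution up to
   subsumption. The comparison is restricted to sets of clauses deduced from A:
   among arbitrary clause sets there is in general no least one, since an
   underivable clause c `<=` r may stand in for a resolvent r. With this
   restriction the least set exists and is unique (lemmas below). *)
Definition is_deductive_closure (A D : cset Sg) : Prop :=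
  closed_extension A D /\ forall S, closed_extension A S -> D `<=` S.

(* The context Gamma of the problem. *)
Definition instances (F : form Sg) (x : nat) (U : seq (term Sg)) :
    seq (form Sg) :=
  [seq subst_form x u F | u <- U].

Definition canonical_solution (F : form Sg) (x : nat) (U : seq (term Sg)) :
    form Sg :=
  bigAnd (instances F x U).

Section Problem.
Variables (F : form Sg) (x : nat).
Variables (alpha : nat) (U V : seq (term Sg)).

Definition is_solution (A : form Sg) : Prop :=
  tautological_sequent
    (rcons (instances F x U)
           (Imp A (bigAnd [seq subst_form alpha s A | s <- V])))
    [::].

Definition is_minimal_solution (B : cset Sg) : Prop :=
  is_solution (cset_form B) /\
  forall B', is_solution (cset_form B') -> cset_size B <= cset_size B'.

Definition generator : Type := cset Sg -> {fset (cset Sg)}.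

Definition well_founded_generator (G : generator) : Prop :=
  exists lt : cset Sg -> cset Sg -> Prop,
    [/\ well_founded lt,
        forall A1 A2 A3, lt A1 A2 -> lt A2 A3 -> lt A1 A3
      & forall A B, B \in G A -> lt B A].

Definition reachable (G : generator) : cset Sg -> cset Sg -> Prop :=
  clos_refl_trans (cset Sg) (fun A B => B \in G A).

Definition complete_generator (G : generator) (A : cset Sg) : Prop :=
  forall B, is_minimal_solution B -> entails (cset_form A) (cset_form B) ->
    reachable G A B.

Definition subset_generator : generator :=
  fun A => [fset B in fpowerset A | #|` B|.+1 == #|` A|].

Definition drop_free (A : cset Sg) : cset Sg :=
  [fset c in A | clause_occurs alpha c].

Definition still_solution (B : cset Sg) : Prop :=
  tautological_sequent
    ([seq subst_form alpha s (cset_form B) | s <- V] ++ instances F x U) [::].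

Definition minima (S : {fset (cset Sg)}) : {fset (cset Sg)} :=
  [fset A in S | all (fun B => cset_size A <= cset_size B) (enum_fset S)].

(* Big-step semantics: [SF G A R] means that the call of the procedure on A
   terminates and returns the set R of the collected clause sets of minimal
   symbol complexity; [rec B] is the result of the recursive call on B. Hence
   termination on A is [exists R, SF G A R]; R is unique (lemma below). *)
Inductive SF (G : generator) : cset Sg -> {fset (cset Sg)} -> Prop :=
| SF_call (A : cset Sg) (rec : cset Sg -> {fset (cset Sg)}) :
    (forall B, B \in G (drop_free A) -> still_solution B -> SF G B (rec B)) ->
    SF G A (minima (drop_free A |`
      \bigcup_(B <- enum_fset (G (drop_free A)) | `[< still_solution B >]) rec B)).

Lemma SF_functional G A R1 R2 : SF G A R1 -> SF G A R2 -> R1 = R2.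
Proof.
move=> h1; elim: h1 R2 => {A R1} A r1 _ IH R2 h2.
case: _ R2 / h2 r1 IH => {}A r2 H r1 IH.
congr (minima (_ |` _)); rewrite big_seq_cond [RHS]big_seq_cond.
by apply: eq_bigr => B /andP[BG /asboolP sB]; apply: (IH) => //; apply: H.
Qed.

End Problem.

Lemma holds_bigAnd v s : holds v (bigAnd s) = all (holds v) s.
Proof. by elim: s => //= A s ->. Qed.

Lemma holds_bigOr v s : holds v (bigOr s) = has (holds v) s.
Proof. by elim: s => //= A s ->. Qed.

Lemma holds_lit v (l : literal Sg) : holds v (lit_form l) = (v l.2 == l.1).
Proof. by case: l => [[] a] /=; case: (v a). Qed.

Lemma clause_holdsP v (c : clause Sg) :
  reflect (exists2 l : literal Sg, l \in c & v l.2 = l.1) (holds v (clause_form c)).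
Proof.
rewrite holds_bigOr has_map; apply: (iffP hasP) => -[l lc].
  by rewrite /= holds_lit => /eqP; exists l.
by move=> e; exists l => //=; rewrite holds_lit e.
Qed.

Lemma cset_holdsP v (A : cset Sg) :
  reflect (forall c, c \in A -> holds v (clause_form c)) (holds v (cset_form A)).
Proof. by rewrite holds_bigAnd all_map; apply: allP. Qed.

Lemma cnf_pair (A : form Sg) :
  exists K L, is_cnf_of K A /\ is_cnf_of L (Neg A).
Proof.
pose pr (K1 K2 : cset Sg) : cset Sg := [fset (c1 : clause Sg) `|` (c2 : clause Sg) | c1 in K1, c2 in K2].
have holdsU v (K1 K2 : cset Sg) :
    holds v (cset_form (K1 `|` K2)) = holds v (cset_form K1) && holds v (cset_form K2).
  apply/cset_holdsP/andP => [h|[/cset_holdsP h1 /cset_holdsP h2] c].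
    by split; apply/cset_holdsP => c cK; apply: h; rewrite inE cK ?orbT.
  by rewrite inE => /orP[]; [apply: h1|apply: h2].
have holdspr v (K1 K2 : cset Sg) :
    holds v (cset_form (pr K1 K2)) = holds v (cset_form K1) || holds v (cset_form K2).
  apply/cset_holdsP/orP => [h|h c /imfset2P /= [c1 c1K [c2 c2K ->]]].
    apply/orP; rewrite -[_ || _]negbK negb_or; apply/negP => /andP[n1 n2].
    have [c1 c1K {}n1] : exists2 c, c \in K1 & ~~ holds v (clause_form c).
      by apply/hasP; rewrite has_predC; move: n1; rewrite holds_bigAnd all_map.
    have [c2 c2K {}n2] : exists2 c, c \in K2 & ~~ holds v (clause_form c).
      by apply/hasP; rewrite has_predC; move: n2; rewrite holds_bigAnd all_map.
    have /h /clause_holdsP [l] : c1 `|` c2 \in pr K1 K2.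
      by apply/imfset2P; exists c1 => //; exists c2.
    by rewrite inE => /orP[lc|lc] vl; [case/clause_holdsP: n1|case/clause_holdsP: n2]; exists l.
  case: h => /cset_holdsP h; apply/clause_holdsP.
    by have /clause_holdsP [l lc vl] := h _ c1K; exists l; rewrite // inE lc.
  by have /clause_holdsP [l lc vl] := h _ c2K; exists l; rewrite // inE lc orbT.
have holds0 v : holds v (cset_form fset0) by apply/cset_holdsP.
have holds1 v (c : clause Sg) : holds v (cset_form [fset c]) = holds v (clause_form c).
  apply/cset_holdsP/idP => [|h d]; first by apply; rewrite inE.
  by rewrite inE => /eqP ->.
have holdsb v : holds v (cset_form [fset fset0]) = false.
  by rewrite holds1; apply/clause_holdsP => -[l]; rewrite inE.
have holdsl v (l : literal Sg) : holds v (cset_form [fset [fset l]]) = (v l.2 == l.1).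
  rewrite holds1; apply/clause_holdsP/eqP => [[k]|vl]; first by rewrite inE => /eqP ->.
  by exists l; rewrite // inE.
elim: A => [a|||A [K [L [h h']]]|A [K [L [h h']]] B [K2 [L2 [g g']]]
  |A [K [L [h h']]] B [K2 [L2 [g g']]]|A [K [L [h h']]] B [K2 [L2 [g g']]]].
- exists [fset [fset (true, a)]], [fset [fset (false, a)]].
  by split=> v; rewrite holdsl /=; case: (v a).
- by exists fset0, [fset fset0]; split=> v; rewrite ?holds0 ?holdsb.
- by exists [fset fset0], fset0; split=> v; rewrite ?holds0 ?holdsb.
- by exists L, K; split=> v; rewrite ?h ?h' //= negbK.
- by exists (K `|` K2), (pr L L2); split=> v; rewrite ?holdsU ?holdspr ?h ?h' ?g ?g' //= negb_and.
- by exists (pr K K2), (L `|` L2); split=> v; rewrite ?holdsU ?holdspr ?h ?h' ?g ?g' //= negb_or.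
- exists (pr L K2), (K `|` L2); split=> v; rewrite ?holdsU ?holdspr ?h ?h' ?g ?g' /= ?implybE //.
  by rewrite negb_or negbK.
Qed.

Lemma cnf_exists (A : form Sg) : exists K, is_cnf_of K A.
Proof. by have [K [_ [h _]]] := cnf_pair A; exists K. Qed.

Lemma deductive_closure_unique (A D1 D2 : cset Sg) :
  is_deductive_closure A D1 -> is_deductive_closure A D2 -> D1 = D2.
Proof.
move=> [c1 l1] [c2 l2]; apply/eqP; rewrite eqEfsubset.
by rewrite (l1 _ c2) (l2 _ c1).
Qed.

Lemma resolvent_subsumed (c1 c2 r d1 d2 : clause Sg) :
  is_resolvent c1 c2 r -> d1 `<=` c1 -> d2 `<=` c2 ->
  [\/ d1 `<=` r, d2 `<=` r | exists2 s, is_resolvent d1 d2 s & s `<=` r].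
Proof.
move=> [l el ->] s1 s2.
have [ld1|ld1] := boolP (l \in d1); last first.
  apply: Or31; apply/fsubsetP => k kd; rewrite !inE (fsubsetP s1 _ kd) andbT.
  by apply/orP; left; apply: contraNneq ld1 => <-.
have [ld2|ld2] := boolP (dual l \in d2); last first.
  apply: Or32; apply/fsubsetP => k kd; rewrite !inE (fsubsetP s2 _ kd) andbT.
  by apply/orP; right; apply: contraNneq ld2 => <-.
apply: Or33; exists ((d1 `\ l) `|` (d2 `\ dual l)); last by rewrite fsetUSS // fsetSD.
exists l => //; apply/fsetP => k; rewrite !inE /=.
apply/andP/eqP => [[k1 k2]|->] //.
apply/eqP; rewrite -in_fset1 -el !inE /=.
by rewrite (fsubsetP s1 _ k1) (fsubsetP s2 _ k2).
Qed.

Lemma closed_extension_subsumes (A S : cset Sg) (c : clause Sg) :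
  closed_extension A S -> derivable A c -> exists2 d, d \in S & d `<=` c.
Proof.
move=> [AS _ cl]; elim=> {c} [c cA|c1 c2 r _ [d1 d1S s1] _ [d2 d2S s2] hr].
  by exists c => //; apply: (fsubsetP AS).
have [?|?|[s hs sr]] := resolvent_subsumed hr s1 s2; [by exists d1|by exists d2|].
by have [d dS ds] := cl _ _ _ d1S d2S hs; exists d => //; apply: fsubset_trans ds sr.
Qed.

Lemma derivable_bounded (A : cset Sg) (c : clause Sg) :
  derivable A c -> c `<=` \bigcup_(d <- enum_fset A) d.
Proof.
elim=> {c} [c cA|c1 c2 r _ s1 _ s2 [l _ ->]].
  by apply: (@bigfcup_sup _ _ _ c xpredT id).
rewrite fsubUset; apply/andP; split.
  exact: fsubset_trans (fsubD1set _ _) s1.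
exact: fsubset_trans (fsubD1set _ _) s2.
Qed.

Lemma derivable_min (A : cset Sg) (c : clause Sg) : derivable A c ->
  exists d, [/\ derivable A d, d `<=` c & forall e, derivable A e -> e `<=` d -> e = d].
Proof.
have [n] := ubnP #|` c|; elim: n c => // n IH c; rewrite ltnS => cn dc.
have [h|] := pselect (forall e, derivable A e -> e `<=` c -> e = c).
  by exists c; split.
move=> /existsNP [e /not_implyP [de /not_implyP [ec ne]]].
have lt : e `<` c by rewrite fproperEneq ec andbT; apply/eqP.
have [d [dd sd md]] := IH e (leq_trans (fproper_ltn_card lt) cn) de.
by exists d; split => //; apply: fsubset_trans sd ec.
Qed.

Lemma deductive_closure_exists (A : cset Sg) : exists D, is_deductive_closure A D.
Proof.
pose P (c : clause Sg) := c \in A \/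
  (derivable A c /\ forall e, derivable A e -> e `<=` c -> e = c).
pose D : cset Sg := [fset c in fpowerset (\bigcup_(d <- enum_fset A) d) | `[< P c >]].
have Pder c : P c -> derivable A c by move=> [/derivable_base|[]].
have DP c : (c \in D) <-> P c.
  split=> [|Pc]; first by rewrite !inE /= => /andP[_ /asboolP].
  rewrite !inE /= fpowersetE (derivable_bounded (Pder _ Pc)) /=.
  exact/asboolP.
exists D; split=> [|S ext].
  split; first by apply/fsubsetP => c cA; apply/DP; left.
    by move=> c /DP /Pder.
  move=> c1 c2 r /DP/Pder d1 /DP/Pder d2 hr.
  have [d [dd dr dm]] := derivable_min (derivable_res d1 d2 hr).
  by exists d => //; apply/DP; right.
apply/fsubsetP => c /DP [cA|[dc mc]]; first by case: ext => /fsubsetP AS _ _; apply: AS.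
have [d dS dsub] := closed_extension_subsumes ext dc.
by case: (ext) => _ /(_ _ dS) dd _; rewrite -(mc _ dd dsub).
Qed.

End Syntax.

(* Main.v *)
(* A minimal solution [B] is a consequence of the canonical solution, so by
   resolution completeness every non-tautological clause of [B] contains a clause
   of [D]. Replacing a clause by a proper subclause in [D], or deleting a clause
   that is a tautology or does not contain [alpha], keeps a solution and
   makes it smaller; hence [B] is a set of clauses of [D] with [alpha]. It is then
   reached by deleting the other clauses one by one, and every intermediate set,
   being stronger than [B], passes the test of the search. *)
Require Import Defs.
From Stdlib Require Import Relation_Operators Wf_nat.
From mathcomp Require Import all_boot finmap.
From mathcomp Require Import boolp zify.

Set Implicit Arguments.
Unset Strict Implicit.
Unset Printing Implicit Defensive.

Local Open Scope fset_scope.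

(** * Substitution and valuations *)

Section Substitution.
Context {Sg : signature}.
Implicit Types (s t : term Sg) (a : atom Sg) (A : form Sg) (c : clause Sg).

Lemma subst_term_id y s t : ~~ occurs_term y t -> subst_term y s t = t.
Proof.
(* The arguments of [App] are nested in a finite function, so the recursion is done by hand. *)
move: t; fix IH 1 => -[z|f a] /=; first by move=> /negPf ->.
move=> nocc; congr App; apply/ffunP => i; rewrite ffunE; apply: IH.
by apply: contra nocc => occ; apply/hasP; exists i; rewrite ?mem_enum.
Qed.

Lemma subst_atom_id y s a : ~~ occurs_atom y a -> subst_atom y s a = a.
Proof.
case: a => p b /= nocc; congr Pred; apply/ffunP => i; rewrite ffunE.
apply: subst_term_id.
by apply: contra nocc => occ; apply/hasP; exists i; rewrite ?mem_enum.
Qed.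

(** Instances of a clause set are not computed below: the substitution is moved into the valuation
    and the clause set stays fixed. *)
Lemma holds_subst v y s A :
  holds v (subst_form y s A) = holds (fun a => v (subst_atom y s a)) A.
Proof. by elim: A => //= [A ->|A -> B ->|A -> B ->|A -> B ->]. Qed.

Lemma clause_holds_subst_id v y s c : ~~ clause_occurs y c ->
  holds (fun a => v (subst_atom y s a)) (clause_form c) =
  holds v (clause_form c).
Proof.
move=> nocc.
have e l : l \in c -> subst_atom y s l.2 = l.2.
  move=> lc; apply: subst_atom_id; apply: contra nocc => occ.
  by apply/hasP; exists l.
by apply/clause_holdsP/clause_holdsP => -[l lc vl]; exists l; rewrite ?e // -vl e.
Qed.

End Substitution.

(** * Soundness and completeness of resolution *)

Section Resolution.
Context {Sg : signature}.
Implicit Types (v : atom Sg -> bool) (K : cset Sg) (c m : clause Sg).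

Definition tautological c := exists2 l, l \in c & dual l \in c.

Lemma tautological_holds v c : tautological c -> holds v (clause_form c).
Proof.
move=> [[b a] l1 l2]; apply/clause_holdsP.
have [e|ne] := eqVneq (v a) b; first by exists (b, a).
by exists (~~ b, a) => //=; case: (v a) b ne {l1 l2} => [] [].
Qed.

Lemma derivable_sound v K c :
  holds v (cset_form K) -> derivable K c -> holds v (clause_form c).
Proof.
move=> /cset_holdsP vK; elim=> {c} [c /vK //|c1 c2 r _ /clause_holdsP [l1 l1c v1] _
  /clause_holdsP [l2 l2c v2] [l _ ->]].
apply/clause_holdsP.
have [e1|n1] := eqVneq l1 l; last by exists l1; rewrite // !inE n1 l1c.
have [e2|n2] := eqVneq l2 (dual l); last by exists l2; rewrite // !inE n2 l2c orbT.
by move: v2; rewrite e2 /= -e1 v1; case: (l1.1).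
Qed.

(* [m] is a branch of a semantic tree for [K], recorded as the clause of the
   literals falsified along it; [s] lists the atoms still to be decided. *)
Lemma derivable_semantic_tree K c (s : seq (atom Sg)) m :
  (forall v, holds v (cset_form K) -> holds v (clause_form c)) ->
  ~ tautological m -> c `<=` m ->
  (forall d l, d \in K -> l \in d -> [|| l.2 \in s, l \in m | dual l \in m]) ->
  exists2 d, derivable K d & d `<=` m.
Proof.
move=> Kc; elim: s m => [|a s IH] m ntm cm cov.
  (* At a leaf every atom of [K] is decided. This valuation falsifies every literal of the
     non-tautological [m]; atoms outside [m] get the value false. *)
  pose v a := (false, a) \in m.
  have vm l : l \in m -> v l.2 != l.1.
    case: l => [[] b] lm; rewrite /v /= ?lm //.
    by apply/negP => /eqP lm'; apply: ntm; exists (true, b).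
  have : ~~ holds v (cset_form K).
    apply/negP => /Kc /clause_holdsP [l lc /eqP vl].
    by have := vm _ (fsubsetP cm _ lc); rewrite vl.
  rewrite holds_bigAnd all_map -has_predC => /hasP [d dK /= /negP nd].
  exists d; first exact: derivable_base.
  apply/fsubsetP => l ld; have /= := cov _ _ dK ld.
  (* If the dual of [l] is in [m], then [v] satisfies [l], hence the clause [d] chosen to be
     false. *)
  case/orP => // lm; case: nd; apply/clause_holdsP; exists l => //.
  by have /= := vm _ lm; case: (v _) (l.1) => [] [].
have skip : (true, a) \in m \/ (false, a) \in m ->
    exists2 d, derivable K d & d `<=` m.
  move=> am; apply: IH => // d l dK ld; have := cov _ _ dK ld.
  rewrite inE -orbA; case: eqVneq => //= la _.
  by case: l la {ld} => [[] a'] /= ->; rewrite /dual /=; case: am => ->; rewrite ?orbT.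
have [t|nt] := boolP ((true, a) \in m); first by apply: skip; left.
have [f|nf] := boolP ((false, a) \in m); first by apply: skip; right.
(* The undecided atom [a] is branched on. A clause found below one branch that avoids the new
   literal already fits into [m]; otherwise the two clauses are resolved on [a]. *)
have ext b : exists2 d, derivable K d & d `<=` (b, a) |` m.
  apply: IH => [[l]|| d l dK ld].
  - rewrite !inE => /orP[/eqP ->|lm] /orP[/eqP e|dm].
    + by case: b e.
    + by case: b dm => /= am; [rewrite am in nf | rewrite am in nt].
    + by case: l e lm => b' a' [_ ->]; case: b' => /= am;
        [rewrite am in nt | rewrite am in nf].
    + by apply: ntm; exists l.
  - by apply: fsubset_trans cm (fsubsetU1 _ _).
  - have := cov _ _ dK ld; rewrite !inE.
    case: l {ld} => b' a' /=; have [->|_] := eqVneq a' a.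
      by case: b b' => [] []; rewrite eqxx ?orbT.
    by rewrite orFb => /or3P[] ->; rewrite ?orbT.
have [d1 K1 s1] := ext true; have [d2 K2 s2] := ext false.
have restr b d : d `<=` (b, a) |` m -> d `\ (b, a) `<=` m.
  move=> /fsubsetP dm; apply/fsubsetP => l; rewrite !inE => /andP[/negPf ne ld].
  by have := dm _ ld; rewrite !inE ne.
have [a1|a1] := boolP ((true, a) \in d1); last first.
  by exists d1 => //; rewrite -(mem_fsetD1 a1); apply: restr.
have [a2|a2] := boolP ((false, a) \in d2); last first.
  by exists d2 => //; rewrite -(mem_fsetD1 a2); apply: restr.
exists ((d1 `\ (true, a)) `|` (d2 `\ (false, a))); last first.
  by rewrite fsubUset !restr.
apply: derivable_res K1 K2 _; exists (true, a) => //.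
(* The resolvent is defined: a second complementary pair would lie in [m] and make it
   tautological. *)
apply/fsetP => l; rewrite !inE; apply/andP/eqP => [[l1 l2]|-> //].
have := fsubsetP s1 _ l1; rewrite !inE => /orP[/eqP //|lm].
have := fsubsetP s2 _ l2; rewrite !inE => /orP[/eqP e|lm'].
  by case: l e {l1 l2 lm} => [[] b] //= [->].
by case: ntm; exists l.
Qed.

Lemma resolution_complete K c :
  (forall v, holds v (cset_form K) -> holds v (clause_form c)) ->
  ~ tautological c -> exists2 d, derivable K d & d `<=` c.
Proof.
move=> Kc ntc.
(* The tree is rooted at the branch that falsifies exactly the literals of [c]; the atoms to decide
   are those of [K]. *)
apply: (@derivable_semantic_tree K c
  [seq l.2 | l <- enum_fset (\bigcup_(d <- enum_fset K) d)]) => // d l dK ld.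
apply/orP; left; apply: map_f; apply: (fsubsetP _ _ ld).
exact: (@bigfcup_sup _ _ _ d xpredT id).
Qed.

End Resolution.

(** * Symbol complexity under deletion and replacement of clauses *)

Section Size.
Context {Sg : signature}.
Implicit Types (A B : cset Sg) (c d : clause Sg).

Lemma clause_size_gt0 c : 0 < clause_size c.
Proof.
rewrite /clause_size; case: eqVneq => // /fset0Pn [l lc].
rewrite (big_fsetD1 l) //= /lit_size; case: l {lc} => b [p g] /=.
by rewrite !addSn.
Qed.

Lemma clause_size_proper d c :
  d != fset0 -> d `<` c -> clause_size d < clause_size c.
Proof.
move=> d0 dc; have lt := fproper_ltn_card dc; have sub := fproper_sub dc.
have c0 : c != fset0.
  by apply: contraNneq d0 => c0; rewrite c0 in sub; rewrite -fsubset0.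
rewrite /clause_size (negPf d0) (negPf c0) (big_fsetID _ (mem d) c) /=.
have -> : [fset l in c | l \in d] = d.
  by apply/fsetP => l; rewrite !inE /= andb_idl // => /(fsubsetP sub).
rewrite -cardfs_gt0 in d0.
(* The literals of [d] cancel, and the number of disjunctions alone gives strictness. As [d] is
   nonempty, the predecessors are not truncated. *)
rewrite -addnA ltn_add2l ltn_addl // -ltnS !prednK //.
exact: leq_ltn_trans lt.
Qed.

Lemma cset_sizeD1 c B : c \in B -> cset_size (B `\ c) < cset_size B.
Proof.
move=> cB; rewrite /cset_size [X in _ < X + _](big_fsetD1 c) //=.
have := clause_size_gt0 c; have := cardfsD1 c B; rewrite cB /=; lia.
Qed.

Lemma cset_size_replace d c B : c \in B -> clause_size d < clause_size c ->
  cset_size (d |` (B `\ c)) < cset_size B.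
Proof.
(* If [d] is already another clause of [B], the replacement amounts to deleting [c]. *)
move=> cB dc; have [dB|dB] := boolP (d \in B `\ c).
  have -> : d |` (B `\ c) = B `\ c by apply/fsetUidPr; rewrite fsub1set.
  exact: cset_sizeD1.
rewrite /cset_size [X in _ < X + _](big_fsetD1 c) //= big_fsetU1 //=.
rewrite cardfsU1 dB (cardfsD1 c B) cB /=; lia.
Qed.

Lemma cset_size_eq0 B : (cset_size B == 0) = (B == fset0).
Proof.
apply/idP/eqP => [|->]; last by rewrite /cset_size big_seq_fset0 cardfs0.
have [//|[c cB]] := fset_0Vmem B.
by have := cset_sizeD1 cB; case: (cset_size B).
Qed.

End Size.

(** * The subset generator: single steps, well-foundedness, reachability *)

Section SubsetGenerator.
Context {Sg : signature}.
Implicit Types (A B : cset Sg).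

Lemma subset_generatorP A B :
  reflect (B `<=` A /\ #|` B|.+1 = #|` A|) (B \in subset_generator A).
Proof.
by rewrite !inE /= fpowersetE; apply: (iffP andP) => -[? /eqP].
Qed.

Lemma subset_generatorD1 A c : c \in A -> A `\ c \in subset_generator A.
Proof.
move=> cA; apply/subset_generatorP; rewrite fsubD1set; split=> //.
by rewrite (cardfsD1 c A) cA.
Qed.

(** Deletes some clause of [A] outside [B]. Both reachability and the search advance towards [B] by
    this step. *)
Lemma fsubset_step A B : B `<=` A -> B != A ->
  exists2 S, S \in subset_generator A & B `<=` S.
Proof.
move=> BA ne.
have : A `\` B != fset0.
  by apply: contra ne; rewrite fsetD_eq0 eqEfsubset BA.
case/fset0Pn=> c; rewrite inE => /andP[cB cA]; exists (A `\ c);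
  first exact: subset_generatorD1.
by rewrite fsubsetD1 BA.
Qed.

Lemma subset_generator_wf : well_founded_generator (@subset_generator Sg).
Proof.
exists (fun A B => (#|` A| < #|` B|)%coq_nat); split.
- exact: well_founded_ltof.
- by move=> A1 A2 A3 /ltP h1 /ltP h2; apply/ltP; apply: ltn_trans h1 h2.
- by move=> A B /subset_generatorP[_ <-]; apply/ltP.
Qed.

Lemma subset_reachable A B : B `<=` A -> reachable (@subset_generator Sg) A B.
Proof.
have [n] := ubnP #|` A|; elim: n A => // n IH A An BA.
have [->|ne] := eqVneq B A; first exact: rt_refl.
have [S SA BS] := fsubset_step BA ne.
apply: (rt_trans _ _ _ S); first exact: rt_step.
by apply: IH => //; case/subset_generatorP: SA => _; lia.
Qed.

End SubsetGenerator.

(** * Solutions and the test of the search *)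

Section Problem.
Variables (Sg : signature) (F : form Sg) (x alpha : nat) (U V : seq (term Sg)).
Implicit Types (v : atom Sg -> bool) (A B : cset Sg) (c : clause Sg).

Local Notation gamma v := (holds v (canonical_solution F x U)).
Local Notation subst_val v s := (fun a => v (subst_atom alpha s a)).
Local Notation solution B := (is_solution F x alpha U V (cset_form B)).
Local Notation still B := (still_solution F x alpha U V B).
Local Notation SFsub := (SF F x alpha U V (@subset_generator Sg)).

Lemma still_solutionP A : still A <->
  forall v, gamma v -> exists2 s, s \in V & ~~ holds (subst_val v s) (cset_form A).
Proof.
rewrite /canonical_solution; split=> h v.
  rewrite holds_bigAnd => gv; have := h v; rewrite all_cat gv andbT all_map.
  have [//|/allPn [s sV /= n]] := boolP (all _ V); first by move=> _ /(_ isT).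
  by move=> _; exists s; rewrite // -holds_subst.
rewrite all_cat all_map -holds_bigAnd => /andP[/allP hV /h [s sV /negP[]]].
by rewrite -holds_subst; apply: hV.
Qed.

(** The implication in the sequent is false exactly when its premise is true and its conclusion
    false, which separates the test of the search from entailment by Gamma. *)
Lemma is_solutionP A : solution A <->
  still A /\ forall v, gamma v -> holds v (cset_form A).
Proof.
rewrite still_solutionP /canonical_solution; split=> [h|[h hA] v].
  have {}h v : gamma v -> holds v (cset_form A) /\
      exists2 s, s \in V & ~~ holds (subst_val v s) (cset_form A).
    rewrite /canonical_solution holds_bigAnd => gv; have := h v.
    rewrite all_rcons gv andbT /= holds_bigAnd all_map.
    case: (holds v _) => /= [|/(_ isT) //].
    have [//|/allPn [s sV /= n]] := boolP (all _ V); first by move=> _ /(_ isT).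
    by move=> _; split=> //; exists s; rewrite // -holds_subst.
  by split=> v /h [].
rewrite all_rcons -holds_bigAnd /= holds_bigAnd all_map => /andP[/implyP imp gv].
have [s sV /negP[]] := h _ gv; rewrite -holds_subst.
by have /allP := imp (hA _ gv); apply.
Qed.

Lemma holds_fsubset v A B :
  B `<=` A -> holds v (cset_form A) -> holds v (cset_form B).
Proof.
by move=> /fsubsetP BA /cset_holdsP h; apply/cset_holdsP => c /BA /h.
Qed.

(** The hypothesis covers all valuations, including those pulled back along a substitution, so an
    instance of [B] fails wherever the same instance of [A] does. *)
Lemma still_solution_stronger A B :
  (forall v, holds v (cset_form B) -> holds v (cset_form A)) ->
  still A -> still B.
Proof.
move=> AB /still_solutionP h; apply/still_solutionP => v /h [s sV n].
by exists s => //; apply: contra n => /AB.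
Qed.

Lemma drop_freeS A : drop_free alpha A `<=` A.
Proof. exact: fset_sub. Qed.

(** A clause without [alpha] is its own instance and follows from Gamma, so it is never the clause
    that makes an instance of [B] fail. *)
Lemma still_solution_remove_free A B : A `<=` B ->
  (forall v, gamma v -> holds v (cset_form B)) ->
  (forall c, c \in B -> c \notin A -> ~~ clause_occurs alpha c) ->
  still B -> still A.
Proof.
move=> AB gB free /still_solutionP h; apply/still_solutionP => v gv.
have [s sV n] := h _ gv; exists s => //; apply: contra n => /cset_holdsP hA.
apply/cset_holdsP => c cB; have [/hA //|cA] := boolP (c \in A).
rewrite clause_holds_subst_id; last exact: free.
by have /cset_holdsP := gB _ gv; apply.
Qed.

Lemma still_solution_drop_free A :
  (forall v, gamma v -> holds v (cset_form A)) ->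
  still A -> still (drop_free alpha A).
Proof.
move=> gA; apply: still_solution_remove_free (drop_freeS A) gA _ => c cA.
by rewrite !inE cA.
Qed.

(** * Minimal solutions inside the deductive closure *)

Section MinimalSolution.
Variables (K D B : cset Sg).
Hypotheses (hK : is_cnf_of K (canonical_solution F x U))
  (hD : is_deductive_closure K D) (minB : is_minimal_solution F x alpha U V B).

Lemma closure_entailed v : gamma v -> holds v (cset_form D).
Proof.
rewrite -hK => vK; apply/cset_holdsP => c cD.
by case: hD => -[_ der _] _; apply: derivable_sound vK (der _ cD).
Qed.

Lemma minimal_still : still B.
Proof. by case: minB => /is_solutionP[]. Qed.

Lemma minimal_entailed v : gamma v -> holds v (cset_form B).
Proof. by case: minB => /is_solutionP[_ gB] _; apply: gB. Qed.

Lemma minimal_le A : still A -> (forall v, gamma v -> holds v (cset_form A)) ->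
  cset_size B <= cset_size A.
Proof. by case: minB => _ h sA gA; apply: h; apply/is_solutionP. Qed.

Lemma minimal_not_tautological c : c \in B -> ~ tautological c.
Proof.
move=> cB tc; have := cset_sizeD1 cB; rewrite ltnNge => /negP; apply.
apply: minimal_le => [|v /minimal_entailed]; last exact/holds_fsubset/fsubD1set.
apply: still_solution_stronger minimal_still => v /cset_holdsP h.
apply/cset_holdsP => d dB; have [->|ne] := eqVneq d c.
  exact: tautological_holds.
by apply: h; rewrite !inE ne.
Qed.

(** Ensures that [drop_free], applied at the start of each call, removes no clause of [B]. *)
Lemma minimal_clause_occurs c : c \in B -> clause_occurs alpha c.
Proof.
move=> cB; apply/negPn/negP => nocc.
have := cset_sizeD1 cB; rewrite ltnNge => /negP; apply.
apply: minimal_le => [|v /minimal_entailed]; last exact/holds_fsubset/fsubD1set.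
apply: still_solution_remove_free (fsubD1set _ _) minimal_entailed _ minimal_still.
by move=> d dB; rewrite !inE dB andbT negbK => /eqP ->.
Qed.

Lemma minimal_fsubset_closure : B `<=` D.
Proof.
apply/fsubsetP => c cB.
have Kc v : holds v (cset_form K) -> holds v (clause_form c).
  by rewrite hK => /minimal_entailed/cset_holdsP; apply.
have [e Ke ec] := resolution_complete Kc (minimal_not_tautological cB).
(* The derived clause [e] need not belong to [D], which is closed only up to subsumption. *)
have [d dD de] := closed_extension_subsumes hD.1 Ke.
have dc := fsubset_trans de ec.
have [<- //|ne] := eqVneq d c.
have gd v : gamma v -> holds v (clause_form d).
  by move=> /closure_entailed/cset_holdsP; apply.
(* The empty clause is as long as a clause consisting of one nullary predicate,
   so that replacing the latter by the former need not decrease the size. *)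
have [d0|d0] := eqVneq d fset0.
  (* With the empty clause in [D], Gamma is unsatisfiable. The empty clause set is then a solution
     of size 0, which forces [B] to be empty. *)
  have ng v : ~~ gamma v.
    by apply/negP => /gd; rewrite d0 => /clause_holdsP [l]; rewrite inE.
  have : cset_size B <= cset_size (fset0 : cset Sg).
    apply: minimal_le => [|v]; last by move/negPf: (ng v) => ->.
    by apply/still_solutionP => v; move/negPf: (ng v) => ->.
  have /eqP -> : cset_size (fset0 : cset Sg) == 0 by rewrite cset_size_eq0.
  by rewrite leqn0 cset_size_eq0 => /eqP B0; rewrite B0 inE in cB.
have lt : clause_size d < clause_size c.
  by apply: clause_size_proper; rewrite // fproperEneq ne.
(* Putting [d] for [c] strengthens [B], so the test still succeeds, and Gamma entails [d]: this is a
   smaller solution. *)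
have := cset_size_replace cB lt; rewrite ltnNge => /negP[]; apply: minimal_le.
  apply: still_solution_stronger minimal_still => v /cset_holdsP h.
  apply/cset_holdsP => f fB; have [->|nf] := eqVneq f c; last first.
    by apply: h; rewrite !inE nf fB orbT.
  have /clause_holdsP [l ld vl] : holds v (clause_form d).
    by apply: h; rewrite !inE eqxx.
  by apply/clause_holdsP; exists l; rewrite // (fsubsetP dc).
move=> v gv; apply/cset_holdsP => f; rewrite !inE => /orP[/eqP ->|/andP[_ fB]].
  exact: gd.
by have /cset_holdsP := minimal_entailed gv; apply.
Qed.

Lemma minimal_fsubset_drop_free A : B `<=` A -> B `<=` drop_free alpha A.
Proof.
move=> /fsubsetP BA; apply/fsubsetP => c cB.
by rewrite !inE BA //= minimal_clause_occurs.
Qed.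

(** Induction on the call. Both claims are needed together: everything collected passes the test
    and, lying within [D], follows from Gamma; so it is a solution, not smaller than [B], and
    [minima] keeps [B]. *)
Lemma SF_sound_complete A R : SFsub A R -> A `<=` D -> still A ->
  (forall X, X \in R -> X `<=` D /\ still X) /\ (B `<=` A -> B \in R).
Proof.
elim=> {A R} A rec _ IH AD sA.
have gD S : S `<=` D -> forall v, gamma v -> holds v (cset_form S).
  by move=> SD v /closure_entailed; apply: holds_fsubset.
have dD : drop_free alpha A `<=` D := fsubset_trans (drop_freeS A) AD.
have subD S : S \in subset_generator (drop_free alpha A) -> S `<=` D.
  by case/subset_generatorP => Sd _; apply: fsubset_trans Sd dD.
rewrite /minima; set collected := drop_free alpha A |` _.
have sound X : X \in collected -> X `<=` D /\ still X.
  rewrite !inE => /orP[/eqP ->|/bigfcupP[S /andP[SG /asboolP sS] XS]].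
    by split=> //; apply: still_solution_drop_free => //; apply: gD.
  by case: (IH _ SG sS (subD _ SG) sS) => + _; apply.
split=> [X|BA]; first by rewrite in_fset => /andP[/sound].
have Bcoll : B \in collected.
  have Bd := minimal_fsubset_drop_free BA.
  (* Either [B] is the pruned set itself, or a one-clause deletion still contains [B], passes the
     test, and its recursive call returns [B]. *)
  rewrite in_fsetU in_fset1; have [//|ne] := eqVneq B (drop_free alpha A).
  have [S SG BS] := fsubset_step Bd ne.
  have sS : still S.
    by apply: still_solution_stronger minimal_still => v; apply: holds_fsubset.
  apply/bigfcupP; exists S; first by rewrite SG; apply/asboolP.
  by case: (IH _ SG sS (subD _ SG) sS) => _; apply.
rewrite in_fset; apply/andP; split=> //; apply/allP => X /sound[XD sX].
by apply: minimal_le => //; apply: gD.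
Qed.

Lemma closure_still : still D.
Proof.
apply: still_solution_stronger minimal_still => v.
exact/holds_fsubset/minimal_fsubset_closure.
Qed.

End MinimalSolution.

(** * Termination of the search and the main result *)

Lemma SF_terminates A : exists R, SFsub A R.
Proof.
have [n] := ubnP #|` A|; elim: n A => // n IH A An.
(* The implication is placed under the existential, with [fset0] as a dummy result, so that choice
   gives a total function [rec]. *)
have ex S : exists R, S \in subset_generator (drop_free alpha A) -> SFsub S R.
  have [SG|_] := boolP (S \in _); last by exists fset0.
  have [|R h] := IH S; last by exists R.
  have := fsubset_leq_card (drop_freeS A).
  by case/subset_generatorP: SG => _; lia.
have [rec hrec] := choice ex.
by eexists; apply: SF_call => S SG _; apply: hrec.
Qed.

End Problem.

Theorem theorem13 (Sg : signature) (F : form Sg) (x alpha : nat)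
  (U V : seq (term Sg)) (K D : cset Sg)
  (hK : is_cnf_of K (canonical_solution F x U))
  (hD : is_deductive_closure K D) :
  [/\ well_founded_generator (@subset_generator Sg),
      complete_generator F x alpha U V (@subset_generator Sg) D,
      forall B : cset Sg, is_minimal_solution F x alpha U V B ->
        exists2 R, SF F x alpha U V (@subset_generator Sg) D R & B \in R
    & forall A : cset Sg,
        exists R, SF F x alpha U V (@subset_generator Sg) A R].
Proof.
split=> [|B minB _|B minB|A].
- exact: subset_generator_wf.
- exact/subset_reachable/(minimal_fsubset_closure hK hD minB).
- have [R h] := SF_terminates F x alpha U V D; exists R => //.
  have [_] := SF_sound_complete hK hD minB h (fsubset_refl D) (closure_still hK hD minB).
  by apply; apply: minimal_fsubset_closure hK hD minB.
- exact: SF_terminates.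
Qed.
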